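(* Let $n\ge 3$ be an integer and let $C_n$ be the cycle of length $n$ (that is, the cycle graph on $n$ vertices). Then $C_n$ is (isomorphic to) the commuting graph of a centrefree semigroup if and only if $n$ is divisible by four.
   Context: For a semigroup $S$ with centre $Z(S)=\{x\in S\mid xs=sx \text{ for all } s\in S\}$, the commuting graph $\Gamma(S)$ is the simple graph with vertex set $S\setminus Z(S)$ in which two distinct vertices $x,y$ are adjacent if and only if $xy=yx$. A semigroup $S$ is centrefree if $Z(S)=\emptyset$. *)

(* Defs.v *)
From mathcomp Require Import all_boot.
From mathcomp Require Import boolp classical_sets.

Set Implicit Arguments.
Unset Strict Implicit.
Unset Printing Implicit Defensive.

Local Open Scope classical_set_scope.
Local Open Scope group_scope.

Record sgraph := SGraph {
  vertex : Type;
  adj : vertex -> vertex -> Prop;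
  adj_sym : forall x y, adj x y -> adj y x;
  adj_irrefl : forall x, ~ adj x x
}.

Definition graph_iso (G H : sgraph) : Prop :=
  exists2 f : vertex G -> vertex H,
    bijective f & forall x y, adj x y <-> adj (f x) (f y).

Definition centre (S : semigroupType) : set S :=
  [set x | forall s : S, x * s = s * x].
Arguments centre : clear implicits.

Definition centrefree (S : semigroupType) : Prop := centre S = set0.

Section CommutingGraph.
Variable S : semigroupType.

Let V : Type := [set: S] `\` centre S.

Definition commuting_adj (x y : V) : Prop :=
  x <> y /\ val x * val y = val y * val x.

Lemma commuting_adj_sym x y : commuting_adj x y -> commuting_adj y x.
Proof. by case=> /nesym. Qed.

Lemma commuting_adj_irrefl x : ~ commuting_adj x x.
Proof. by case. Qed.

Definition commuting_graph : sgraph :=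
  SGraph commuting_adj_sym commuting_adj_irrefl.

End CommutingGraph.

(* [ordS i] is the successor of [i] modulo [n].  The clause [i <> j] only
   matters for n = 1, where it removes the loop. *)
Definition cycle_adj n (i j : 'I_n) : Prop :=
  i <> j /\ (j = ordS i \/ i = ordS j).

Lemma cycle_adj_sym n (i j : 'I_n) : cycle_adj i j -> cycle_adj j i.
Proof. by case=> nij [] e; split; [exact/nesym | right | exact/nesym | left]. Qed.

Lemma cycle_adj_irrefl n (i : 'I_n) : ~ cycle_adj i i.
Proof. by case. Qed.

Definition cycle_graph n : sgraph :=
  SGraph (@cycle_adj_sym n) (@cycle_adj_irrefl n).

(* Main.v *)
(* Let x_i (i mod n) enumerate a centrefree semigroup whose commuting graph is
   C_n, n >= 5.  Comparing closed neighbourhoods, x_i^2 = x_i and x_i x_{i+1} is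
   x_i or x_{i+1}, so neighbours are comparable for the natural order of the
   band.  Comparability is transitive and implies commutation, hence the order
   alternates along the cycle: n = 2m with lower elements a_i and upper elements
   b_i above a_i and a_{i+1}.  Each {a_i, a_{i+1}} is a left-zero or a right-zero
   pair, and all these pairs are of the same kind, for otherwise two consecutive
   b's would commute.  If they are left-zero, so are the b's, and
   a_k |-> b_0 a_k maps onto {a_0, a_1} and alternates with k, so m is even.

   Conversely, for 4 | n, multiply in Z/n by i * j = i, except that for i odd
   and j even i * j is the neighbour of i congruent to j modulo 4. *)
Require Import Defs.
From mathcomp Require Import all_boot.
From mathcomp Require Import boolp classical_sets.
From HB Require Import structures.
From mathcomp Require Import zify.

Set Implicit Arguments.
Unset Strict Implicit.
Unset Printing Implicit Defensive.

(** * Zigzags of idempotents *)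

(* An infinite stretch of the cycle, a_0 < b_0 > a_1 < b_1 > ..., read off
   the universal cover: indices are naturals and a, b need not be injective. *)
Record zigzag (T : Type) (op : T -> T -> T) (a b : nat -> T) : Prop := Zigzag {
  zz_assoc : associative op;
  zz_aa : forall i, op (a i) (a i) = a i;
  zz_bb : forall i, op (b i) (b i) = b i;
  zz_ab : forall i, op (a i) (b i) = a i;
  zz_ba : forall i, op (b i) (a i) = a i;
  zz_aSb : forall i, op (a i.+1) (b i) = a i.+1;
  zz_baS : forall i, op (b i) (a i.+1) = a i.+1;
  zz_cent_a : forall i y, op y (a i.+1) = op (a i.+1) y ->
    [\/ y = b i, y = a i.+1 | y = b i.+1];
  zz_cent_b : forall i y, op y (b i) = op (b i) y ->
    [\/ y = a i, y = b i | y = a i.+1];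
  zz_naa : forall i, op (a i) (a i.+1) <> op (a i.+1) (a i);
  zz_nbb : forall i, op (b i) (b i.+1) <> op (b i.+1) (b i);
  zz_nab : forall i, op (a i) (b i.+1) <> op (b i.+1) (a i);
  zz_nba : forall i, op (b i) (a i.+2) <> op (a i.+2) (b i)
}.

(** All conditions survive reversal of the product, so right-zero pairs reduce to left-zero ones. *)
Lemma zigzag_dual T op (a b : nat -> T) :
  zigzag op a b -> zigzag (fun x y => op y x) a b.
Proof.
case=> hA haa hbb hab hba haSb hbaS hca hcb naa nbb nab nba; split=> // *.
- exact: hca.
- exact: hcb.
- exact/nesym.
- exact/nesym.
- exact/nesym.
- exact/nesym.
Qed.

(** The element [op b a0] absorbs [a1] on the right, hence also [b], so it commutes with [b]. Of the
    three candidates, [b] is impossible and [a2] collapses to [a1]. *)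
Lemma corner_mul T (op : T -> T -> T) a0 a1 a2 b : associative op ->
  op a0 a1 = a0 -> op a2 a1 = a1 -> op b b = b -> op b a1 = a1 ->
  op a1 b = a1 -> b <> a1 ->
  (forall y, op y b = op b y -> [\/ y = a1, y = b | y = a2]) ->
  op b a0 = a1.
Proof.
move=> opA a01 a21 bb ba1 a1b nb hb.
have ba0a1 : op (op b a0) a1 = op b a0 by rewrite -opA a01.
have [//|e|e] : [\/ op b a0 = a1, op b a0 = b | op b a0 = a2].
- by apply: hb; rewrite opA bb -ba0a1 -opA a1b.
- by case: nb; rewrite -e -ba0a1 e ba1.
- by rewrite e -a21 -e.
Qed.

(** The product is fixed by [b] on both sides, so it is [x], [b] or [y]; multiplying by [x] on the
    left turns the value [b] into [x = b]. *)
Lemma lower_mul T (op : T -> T -> T) x y b : associative op ->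
  op x x = x -> op x b = x -> op b x = x -> op y b = y -> b <> x ->
  (forall z, op z b = op b z -> [\/ z = x, z = b | z = y]) ->
  op x y = x \/ op x y = y.
Proof.
move=> opA xx xb bx yb nb hb.
have [|e|e|e] := hb (op x y); [|by left| |by right].
- by rewrite -opA yb opA bx.
- by case: nb; rewrite -e -{1}xx -opA e xb.
Qed.

Section Zigzag.
Variables (T : Type) (op : T -> T -> T) (a b : nat -> T).
Hypothesis ab : zigzag op a b.

Definition left_zero (x y : T) := op x y = x /\ op y x = y.
Definition right_zero (x y : T) := op x y = y /\ op y x = x.

Lemma zz_b_neq_a i : b i <> a i.
Proof.
by move=> e; apply: (zz_naa ab (i := i)); rewrite -e (zz_aSb ab) (zz_baS ab).
Qed.

Lemma zz_b_neq_aS i : b i <> a i.+1.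
Proof.
by move=> e; apply: (zz_naa ab (i := i)); rewrite -e (zz_ab ab) (zz_ba ab).
Qed.

Lemma left_or_right_zero i :
  left_zero (a i) (a i.+1) \/ right_zero (a i) (a i.+1).
Proof.
have hb := zz_cent_b ab (i := i); have nc := zz_naa ab (i := i).
have hb' y : op y (b i) = op (b i) y -> [\/ y = a i.+1, y = b i | y = a i].
  by move=> /hb[] ->; [constructor 3 | constructor 2 | constructor 1].
have h1 : op (a i) (a i.+1) = a i \/ op (a i) (a i.+1) = a i.+1.
  by apply: lower_mul (zz_assoc ab) (zz_aa ab i) (zz_ab ab i) (zz_ba ab i)
    (zz_aSb ab i) (@zz_b_neq_a i) hb.
have h2 : op (a i.+1) (a i) = a i.+1 \/ op (a i.+1) (a i) = a i.
  by apply: lower_mul (zz_assoc ab) (zz_aa ab _) (zz_aSb ab i) (zz_baS ab i)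
    (zz_ab ab i) (@zz_b_neq_aS i) hb'.
rewrite /left_zero /right_zero.
by case: h1 h2 nc => [->|->] [] -> // _; [left | right].
Qed.

(* In the mixed case both products of b_i and b_{i+1} would equal a_{i+1}. *)
Lemma left_zero_step i :
  left_zero (a i) (a i.+1) -> left_zero (a i.+1) (a i.+2).
Proof.
move=> [a01 a10]; have [//|[a12 a21]] := left_or_right_zero i.+1.
have opA := zz_assoc ab.
have b1a0 : op (b i.+1) (a i) = a i.+1.
  by apply: corner_mul opA a01 a21 (zz_bb ab _) (zz_ba ab _) (zz_ab ab _)
    (@zz_b_neq_a _) (zz_cent_b ab (i := i.+1)).
have a2b0 : op (a i.+2) (b i) = a i.+1.
  (* Mirror image: [corner_mul] for the reversed product, with [a i] and [a i.+2] exchanged. *)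
  have da := zigzag_dual ab.
  apply: (corner_mul (op := fun x y => op y x) (zz_assoc da) a12 a10
    (zz_bb da _) (zz_baS da _) (zz_aSb da _) (@zz_b_neq_aS _)) => y.
  by move=> /(zz_cent_b da)[] ->;
    [constructor 3 | constructor 2 | constructor 1].
have n0 : a i.+1 <> a i.
  by move=> e; apply: (zz_naa ab (i := i)); rewrite a01 a10.
have n2 : a i.+1 <> a i.+2.
  by move=> e; apply: (zz_naa ab (i := i.+1)); rewrite a12 a21.
case: (zz_nbb ab (i := i)).
(* Both products commute with [a i.+1]; [b1a0] and [a2b0] exclude the values [b i] and [b i.+1]. *)
have -> : op (b i) (b i.+1) = a i.+1.
  have [|e|//|e] := zz_cent_a ab (i := i) (y := op (b i) (b i.+1)).
  - by rewrite -opA (zz_ba ab) (zz_baS ab) opA (zz_aSb ab) (zz_ab ab).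
  - by case: n0; rewrite -(zz_baS ab i) -b1a0 opA e (zz_ba ab).
  - by case: n2; rewrite -(zz_ab ab i.+1) -a2b0 -opA e (zz_aSb ab).
have [|e|//|e] := zz_cent_a ab (i := i) (y := op (b i.+1) (b i)).
- by rewrite -opA (zz_baS ab) (zz_ba ab) opA (zz_ab ab) (zz_aSb ab).
- by case: n0; rewrite -b1a0 -{1}(zz_ba ab i) opA e (zz_ba ab).
- by case: n2; rewrite -a2b0 -{1}(zz_aSb ab i.+1) -opA e (zz_aSb ab).
Qed.

Hypothesis ab0 : left_zero (a 0) (a 1).

Lemma left_zero_aS i : left_zero (a i) (a i.+1).
Proof. by elim: i => [|i IH] //; apply: left_zero_step. Qed.

(** Both products commute with [a i.+1]. A right-zero value would make some [b] commute with an [a]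
    three places away on the cycle; the value [a i.+1] contradicts idempotence or noncommutation. *)
Lemma left_zero_bS i : left_zero (b i) (b i.+1).
Proof.
have opA := zz_assoc ab.
have [a01 a10] := left_zero_aS i; have [a12 a21] := left_zero_aS i.+1.
have comm_a : forall x y, (x = b i /\ y = b i.+1) \/ (x = b i.+1 /\ y = b i) ->
    [\/ op x y = b i, op x y = a i.+1 | op x y = b i.+1].
  move=> x y xy; apply: (zz_cent_a ab).
  by case: xy => [[-> ->]|[-> ->]];
    rewrite -opA !(zz_ba ab, zz_baS ab) opA !(zz_ab ab, zz_aSb ab).
have n1 : op (b i) (b i.+1) <> b i.+1.
  move=> e; apply: (zz_nba ab (i := i)).
  by rewrite -{2}a21 -opA (zz_aSb ab) a21 -{1}(zz_baS ab i.+1) opA e (zz_baS ab).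
have n0 : op (b i.+1) (b i) <> b i.
  move=> e; apply: (zz_nab ab (i := i)).
  by rewrite -{1}a01 -opA (zz_ab ab) a01 -{2}(zz_ba ab i) opA e (zz_ba ab).
have [e0|e0|//] := comm_a (b i) (b i.+1) (or_introl (conj erefl erefl)).
- have [//|e1|//] := comm_a (b i.+1) (b i) (or_intror (conj erefl erefl)).
  case: (@zz_b_neq_aS i).
  by rewrite -(zz_bb ab i) -{1}e0 -opA e1 (zz_baS ab).
- have [//|e1|e1] := comm_a (b i.+1) (b i) (or_intror (conj erefl erefl)).
  + by case: (zz_nbb ab (i := i)); rewrite e0 e1.
  + case: (@zz_b_neq_a i.+1).
    by rewrite -(zz_bb ab i.+1) -{1}e1 -opA e0 (zz_ba ab).
Qed.

Lemma left_zero_iter (c : nat -> T) : (forall i, op (c i) (c i) = c i) ->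
  (forall i, left_zero (c i) (c i.+1)) -> forall i, left_zero (c 0) (c i).
Proof.
move=> cc cS; have opA := zz_assoc ab; elim=> [|i [IH1 IH2]]; first by split.
have [e1 e2] := cS i; split; first by rewrite -{1}IH1 -opA e1 IH1.
by rewrite -{1}e2 -opA IH2 e2.
Qed.

(* Left multiplication by b_0 never identifies a_k and a_{k+1}, since
   b_k b_0 = b_k. *)
Lemma fold_b0 k : op (b 0) (a k) = if odd k then a 1 else a 0.
Proof.
have opA := zz_assoc ab.
have la := left_zero_iter (zz_aa ab) left_zero_aS.
have lb := left_zero_iter (zz_bb ab) left_zero_bS.
have fold2 j : op (b 0) (a j) = a 0 \/ op (b 0) (a j) = a 1.
  have e : op (op (b 0) (a j)) (a 0) = op (b 0) (a j).
    by rewrite -opA (proj2 (la j)).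
  have [|->|e1|->] := zz_cent_b ab (i := 0) (y := op (b 0) (a j)); auto.
  - by rewrite opA (zz_bb ab) -{1}e -opA (zz_ab ab) e.
  - by case: (@zz_b_neq_a 0); rewrite -e1 -e e1 (zz_ba ab).
have n j : op (b 0) (a j) <> op (b 0) (a j.+1).
  move=> e; apply: (zz_naa ab (i := j)); have [-> ->] := left_zero_aS j.
  by rewrite -(zz_ba ab j) -(zz_baS ab j) -(proj2 (lb j)) -!opA e.
elim: k => [|k IH]; first by rewrite (zz_ba ab).
have := n k; rewrite IH /=.
by case: (fold2 k.+1) => ->; case: (odd k).
Qed.

Lemma left_zigzag_period_even m : a m = a 0 -> ~~ odd m.
Proof.
move=> e; apply/negP => om; have := fold_b0 m.
rewrite e om (zz_ba ab) => e1; apply: (zz_naa ab (i := 0)).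
by rewrite -e1.
Qed.

End Zigzag.

Lemma zigzag_period_even T op (a b : nat -> T) m :
  zigzag op a b -> a m = a 0 -> ~~ odd m.
Proof.
move=> ab; have [l|[r1 r2]] := left_or_right_zero ab 0.
  exact: left_zigzag_period_even ab l m.
by apply: (left_zigzag_period_even (zigzag_dual ab)); split.
Qed.

(** * From commutation along a cycle to a zigzag *)

Section CyclicEnumeration.
Variables (T : Type) (op : T -> T -> T) (n : nat) (x : nat -> T).
Hypothesis opA : associative op.
Hypothesis n_gt1 : 1 < n.
Hypothesis x_per : forall i, x (i + n) = x i.
Hypothesis x_comm1 : forall i, op (x i) (x i.+1) = op (x i.+1) (x i).
Hypothesis x_ncomm2 : forall i, op (x i) (x i.+2) <> op (x i.+2) (x i).
Hypothesis x_ncomm3 : forall i, op (x i) (x i.+3) <> op (x i.+3) (x i).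
Hypothesis x_cent : forall i y, op y (x i.+1) = op (x i.+1) y ->
  [\/ y = x i, y = x i.+1 | y = x i.+2].

Lemma x_neqS i : x i <> x i.+1.
Proof. by move=> e; apply: (x_ncomm2 (i := i)); rewrite e x_comm1. Qed.

(** A square commutes with both neighbours of its root, and [x_cent] leaves only the root itself. *)
Lemma x_idem i : op (x i) (x i) = x i.
Proof.
(* Moving up one period gives the index the predecessors that [x_cent] needs. *)
rewrite -x_per; have -> : i + n = (i + (n - 2)).+2 by lia.
move: (i + _) => j.
have h1 : op (op (x j.+2) (x j.+2)) (x j.+1) =
    op (x j.+1) (op (x j.+2) (x j.+2)).
  by rewrite -opA -x_comm1 opA -x_comm1 -opA.
have h3 : op (op (x j.+2) (x j.+2)) (x j.+3) =
    op (x j.+3) (op (x j.+2) (x j.+2)).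
  by rewrite -opA x_comm1 opA x_comm1 -opA.
have [e|e|//] := x_cent h1; rewrite e in h3.
- by case: (x_ncomm3 h3).
- by case: (x_ncomm2 h3).
Qed.

(** As the two elements commute, this puts [x i] below [x i.+1] in the natural order. *)
Definition ascent i := op (x i) (x i.+1) = x i.

(** The product commutes with [x i.+1]; were it [x i.+2], that element would commute with [x i]. *)
Lemma descentP i : ~ ascent i <-> op (x i) (x i.+1) = x i.+1.
Proof.
split=> [na|e ai]; last by apply: (@x_neqS i); rewrite -ai.
have [|//|//|e] := @x_cent i (op (x i) (x i.+1)).
  by rewrite -opA x_idem opA -x_comm1 -opA x_idem.
case: (x_ncomm2 (i := i)); rewrite -e opA x_idem.
by rewrite x_comm1 -opA x_idem.
Qed.

(** Two ascents or two descents in a row would make [x i] and [x i.+2] comparable, hence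
    commuting. *)
Lemma ascentS i : ascent i.+1 <-> ~ ascent i.
Proof.
rewrite {1}/ascent; split=> [u1|/descentP d0].
  rewrite /ascent => u0; apply: (x_ncomm2 (i := i)).
  have -> : op (x i) (x i.+2) = x i by rewrite -u0 -opA u1.
  by rewrite -{2}u0 x_comm1 opA -(x_comm1 i.+1) u1 -x_comm1.
have [//|/descentP d1] := pselect (ascent i.+1).
case: (x_ncomm2 (i := i)).
have -> : op (x i) (x i.+2) = x i.+2 by rewrite -d1 opA d0.
by rewrite -{2}d1 x_comm1 -opA -(x_comm1 i) d0 -x_comm1.
Qed.

Lemma ascent_parity i : ascent i <-> (if odd i then ~ ascent 0 else ascent 0).
Proof.
elim: i => [|i IH] //; rewrite ascentS /=.
by case: (odd i) IH => /= IH; rewrite IH ?notK.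
Qed.

Lemma cycle_length_even : ~~ odd n.
Proof.
apply/negP => on; have := ascent_parity n; rewrite on.
have -> : ascent n = ascent 0 by rewrite /ascent -addn1 addnC !x_per -(x_per 0).
tauto.
Qed.

Lemma cycle_length_dvd4 : 4 %| n.
Proof.
(* Starting at an ascent makes the [a k] lower and the [b k] upper elements. *)
have [s us] : exists s, ascent s.
  have [u|u] := pselect (ascent 0); first by exists 0.
  by exists 1; apply/ascentS.
have up k : ascent (s + k.*2).
  elim: k => [|k IH]; first by rewrite addn0.
  by rewrite doubleS !addnS; apply/ascentS => /ascentS.
have down k : op (x (s + k.*2).+1) (x (s + k.+1.*2)) = x (s + k.+1.*2).
  by rewrite doubleS !addnS; apply/descentP => /ascentS.
pose a k := x (s + k.*2); pose b k := x (s + k.*2).+1.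
have aS k : a k.+1 = x (s + k.*2).+2 by rewrite /a doubleS !addnS.
have bS k : b k.+1 = x (s + k.*2).+3 by rewrite /b doubleS !addnS.
have zz : zigzag op a b.
  split=> // [i|i|i|i|i y|i y|i|i|i|i].
  - exact: x_idem.
  - exact: x_idem.
  - by rewrite /a /b -x_comm1 up.
  - by rewrite aS /b -x_comm1 -aS down.
  - by rewrite aS bS; apply: x_cent.
  - by rewrite aS; apply: x_cent.
  - by rewrite aS; apply: x_ncomm2.
  - by rewrite bS; apply: x_ncomm2.
  - by rewrite bS; apply: x_ncomm3.
  - by rewrite aS -[b i]/(x _.+1) /a doubleS !addnS; apply: x_ncomm3.
have n2 := cycle_length_even.
have nE : n = n./2.*2 by lia.
(* One turn round the cycle is [n./2] zigzag steps. *)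
have /(zigzag_period_even zz) : a n./2 = a 0 by rewrite /a -nE x_per addn0.
lia.
Qed.

End CyclicEnumeration.

Lemma modn_addl_inj n i d e : d < n -> e < n -> i + d = i + e %[mod n] -> d = e.
Proof. by move=> dn en /eqP; rewrite eqn_modDl !modn_small // => /eqP. Qed.

(** * Reading a commuting graph around the cycle *)

Section CommutingCycle.
Variables (n : nat) (S : semigroupType).
Hypothesis n_gt0 : 0 < n.
Hypothesis S_centrefree : centrefree S.
Variable f : 'I_n -> vertex (commuting_graph S).
Hypothesis f_bij : bijective f.
Hypothesis f_adj : forall i j, cycle_adj i j <-> commuting_adj (f i) (f j).

Definition cycle_elt i : S := val (f (Ordinal (ltn_pmod i n_gt0))).

Lemma cycle_elt_per i : cycle_elt (i + n) = cycle_elt i.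
Proof. by congr (val (f _)); apply: val_inj; rewrite /= modnDr. Qed.

Lemma cycle_elt_comm i j :
  (cycle_elt i * cycle_elt j = cycle_elt j * cycle_elt i)%g <->
  [\/ i = j %[mod n], j = i.+1 %[mod n] | i = j.+1 %[mod n]].
Proof.
rewrite /cycle_elt.
set u := Ordinal (ltn_pmod i n_gt0); set v := Ordinal (ltn_pmod j n_gt0).
have uS : (v = ordS u) <-> j = i.+1 %[mod n].
  split=> [/(congr1 val)/= e|e]; first by rewrite e -addn1 modnDml addn1.
  by apply: val_inj; rewrite /= e -[in RHS]addn1 modnDml addn1.
have vS : (u = ordS v) <-> i = j.+1 %[mod n].
  split=> [/(congr1 val)/= e|e]; first by rewrite e -addn1 modnDml addn1.
  by apply: val_inj; rewrite /= e -[in RHS]addn1 modnDml addn1.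
have uv : (u = v) <-> i = j %[mod n].
  by split=> [/(congr1 val)//|e]; apply: val_inj.
rewrite -(propext uS) -(propext vS) -(propext uv); have [->|nuv] := eqVneq u v.
  by split=> // _; constructor 1.
split=> [c|[e|e|e]].
- have /f_adj[_ []] : commuting_adj (f u) (f v).
    by split=> // /(bij_inj f_bij) e; rewrite e eqxx in nuv.
  + by constructor 2.
  + by constructor 3.
- by rewrite e eqxx in nuv.
- by have /f_adj[] : cycle_adj u v by split; [exact/eqP | left].
- by have /f_adj[] : cycle_adj u v by split; [exact/eqP | right].
Qed.

Lemma cycle_elt_surj (y : S) : exists i, y = cycle_elt i.
Proof.
have yV : y \in ([set: S] `\` centre S)%classic.
  by apply/mem_set; split=> //; rewrite (_ : centre S = set0).
case: f_bij => g _ gK; exists (g (Sub y yV)).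
rewrite /cycle_elt (_ : Ordinal _ = g (Sub y yV)) ?gK ?SubK //.
by apply: val_inj; rewrite /= modn_small.
Qed.

Lemma commuting_cycle_dvd4 : 3 <= n -> 4 %| n.
Proof.
move=> n_ge3; have comm1 i :
    (cycle_elt i * cycle_elt i.+1 = cycle_elt i.+1 * cycle_elt i)%g.
  by apply/cycle_elt_comm; constructor 2.
(* In a triangle every vertex would be central. *)
have [n_le3|n_gt3] := leqP n 3.
  have n3 : n = 3 by lia.
  suff : centre S (cycle_elt 0) by rewrite S_centrefree.
  move=> y; have [i ->] := cycle_elt_surj y; apply/cycle_elt_comm.
  have : i %% n < 3 by rewrite n3 ltn_pmod.
  rewrite n3; case E : (i %% 3) => [|[|[|//]]] _;
    [constructor 1|constructor 2|constructor 3] => //.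
  by rewrite -(addn1 i) -modnDml E.
(* The case [n = 4] is separate: there [i] and [i + 3] are adjacent, so [x_ncomm3] fails. *)
have [n_le4|n_gt4] := leqP n 4; first by have -> : n = 4 by lia.
have ncomm i d : 1 < d < n.-1 ->
    (cycle_elt i * cycle_elt (i + d) <> cycle_elt (i + d) * cycle_elt i)%g.
  move=> dn /cycle_elt_comm[].
  - by rewrite -{1}[i]addn0 => /modn_addl_inj; lia.
  - by rewrite -addn1 => /modn_addl_inj; lia.
  - by rewrite -{1}[i]addn0 -addnS => /modn_addl_inj; lia.
apply: (@cycle_length_dvd4 S (@mul S) n cycle_elt) => // [|||i|i|i y].
- exact: mulgA.
- by lia.
- exact: cycle_elt_per.
- by rewrite -addn2; apply: ncomm; lia.
- by rewrite -addn3; apply: ncomm; lia.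
have [k ->] := cycle_elt_surj y => /cycle_elt_comm.
have cong j : k = j %[mod n] -> cycle_elt k = cycle_elt j.
  by move=> e; congr (val (f _)); apply: val_inj.
case=> e.
- by constructor 2; apply: cong.
- constructor 1; apply: cong.
  by apply/eqP; rewrite -(eqn_modDr 1) !addn1 e.
- by constructor 3; apply: cong.
Qed.

End CommutingCycle.

(** * The semigroup on Z/n for n divisible by four *)

Section FoldSemigroup.
Variable n : nat.
Hypothesis n_dvd4 : 4 %| n.
Implicit Types i j k l : 'I_n.

Definition fold_mul i j : 'I_n :=
  if odd i && ~~ odd j then
    if i.+1 == j %[mod 4] then ordS i else ord_pred i
  else i.

Lemma ordS_mod4 i : ordS i = i.+1 %[mod 4].
Proof. by rewrite /= modn_dvdm. Qed.

Lemma ord_pred_mod4 i : (ord_pred i).+1 = i %[mod 4].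
Proof. by rewrite -{2}(ord_predK i) ordS_mod4. Qed.

Lemma fold_mul_even i j : ~~ odd i -> fold_mul i j = i.
Proof. by rewrite /fold_mul => /negPf->. Qed.

Lemma fold_mul_odd i j : odd j -> fold_mul i j = i.
Proof. by rewrite /fold_mul => ->; rewrite andbF. Qed.

Lemma fold_mul_mod4 i j : odd i -> ~~ odd j -> fold_mul i j = j %[mod 4].
Proof.
move=> io je; rewrite /fold_mul io je /=.
case: eqP => [<-|]; first exact: ordS_mod4.
by have := ord_pred_mod4 i; lia.
Qed.

Lemma fold_mul_odd_even i j : odd i -> ~~ odd j -> ~~ odd (fold_mul i j).
Proof. by move=> io je; have := fold_mul_mod4 io je; lia. Qed.

Lemma fold_mul_congr i j k : j = k %[mod 4] -> fold_mul i j = fold_mul i k.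
Proof.
by move=> e; rewrite /fold_mul e (_ : odd j = odd k) //; lia.
Qed.

(** The key case is [i], [j] odd and [k] even: [fold_mul j k] keeps the residue of [k] modulo 4,
    which is all that matters to [i]. *)
Lemma fold_mulA : associative fold_mul.
Proof.
move=> i j k; have [io|ie] := boolP (odd i); last by rewrite !fold_mul_even.
have [jo|je] := boolP (odd j).
  rewrite (fold_mul_odd i jo); have [ko|ke] := boolP (odd k).
    by rewrite (fold_mul_odd _ ko) !fold_mul_odd.
  exact/fold_mul_congr/fold_mul_mod4.
by rewrite (fold_mul_even k je) (fold_mul_even k (fold_mul_odd_even io je)).
Qed.

(** Since [fold_mul j i = j] for even [j], the equation expresses commutation. *)
Lemma fold_mul_fix i j : odd i -> ~~ odd j ->
  fold_mul i j = j <-> j = ordS i \/ i = ordS j.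
Proof.
move=> io je; rewrite /fold_mul io je /=; split.
  by case: ifP => _ <-; [left | right; rewrite ord_predK].
case=> [e|e]; first by rewrite -(ordS_mod4 i) e eqxx.
(* With [i = ordS j], the successor of [i] is [j + 2] modulo 4, so the test fails and the
   predecessor [j] is chosen. *)
case: eqP => [h|_]; last by rewrite e ordSK.
by have := ordS_mod4 j; rewrite -e; lia.
Qed.

(** Elements of equal parity form left-zero pairs and are never adjacent; mixed parity is
    [fold_mul_fix]. *)
Lemma fold_mul_comm i j :
  fold_mul i j = fold_mul j i <-> i = j \/ cycle_adj i j.
Proof.
have par k : odd (ordS k) = ~~ odd k by have := ordS_mod4 k; lia.
have odd_even k l : odd k -> ~~ odd l ->
    (fold_mul k l = fold_mul l k <-> k = l \/ cycle_adj k l).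
  move=> ko le; rewrite (fold_mul_even k le) fold_mul_fix //.
  have nkl : k <> l by move=> e; rewrite -e ko in le.
  by split=> [|[//|[]//]]; right.
have [io|ie] := boolP (odd i); have [jo|je] := boolP (odd j).
- rewrite !fold_mul_odd //; split=> [|[//|[_ []]]]; first by left.
  + by move=> /(congr1 (odd \o val)); rewrite /= par io jo.
  + by move=> /(congr1 (odd \o val)); rewrite /= par io jo.
- exact: odd_even.
- have h := odd_even _ _ jo ie.
  split=> [/esym/h[/esym|/cycle_adj_sym]|[->//|]]; auto.
  by move=> /cycle_adj_sym a; apply/esym/h; right.
- rewrite !fold_mul_even //; split=> [|[//|[_ []]]]; first by left.
  + by move=> /(congr1 (odd \o val)); rewrite /= par (negPf ie) (negPf je).
  + by move=> /(congr1 (odd \o val)); rewrite /= par (negPf ie) (negPf je).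
Qed.

(* The phantom argument lets instance inference recover the divisibility proof
   that associativity needs. *)
Definition fold_semigroup of 4 %| n : Type := 'I_n.
HB.instance Definition _ := Choice.on (fold_semigroup n_dvd4).
HB.instance Definition _ := isSemigroup.Build (fold_semigroup n_dvd4) fold_mulA.

Lemma fold_semigroup_centrefree : 0 < n -> centrefree (fold_semigroup n_dvd4).
Proof.
move=> n_gt0; have n_ge4 : 4 <= n by apply: dvdn_leq.
rewrite /centrefree -classical_sets.subset0 => i /= ci.
(* As [n >= 4], [i + 2] is neither [i] nor adjacent to it. *)
have := ci (Ordinal (ltn_pmod (i + 2) n_gt0)).
case/fold_mul_comm => [|[_ []]] /(congr1 val) /=.
- by rewrite -[X in X = _](modn_small (ltn_ord i)) -{1}[nat_of_ord i]addn0;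
    move=> /modn_addl_inj; lia.
- by rewrite -(addn1 i) => /modn_addl_inj; lia.
- rewrite -(addn1 (_ %% n)) modnDml -addnA -[X in X = _](modn_small (ltn_ord i)).
  by rewrite -{1}[nat_of_ord i]addn0 => /modn_addl_inj; lia.
Qed.

Lemma cycle_iso_fold_semigroup : 0 < n ->
  graph_iso (cycle_graph n) (commuting_graph (fold_semigroup n_dvd4)).
Proof.
move=> n_gt0.
have inV (i : fold_semigroup n_dvd4) :
    i \in ([set: fold_semigroup n_dvd4] `\`
           centre (fold_semigroup n_dvd4))%classic.
  by apply/mem_set; split=> //; rewrite (fold_semigroup_centrefree n_gt0).
exists (fun i => Sub i (inV i)).
  exists val => [i|v]; first exact: SubK.
  by apply: val_inj; exact: SubK.
move=> i j; split=> [ij|[nij]].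
  by split; [case: ij => nij _ /(congr1 val) | apply/fold_mul_comm; right].
by move=> /fold_mul_comm[e|//]; case: nij; apply: val_inj.
Qed.

End FoldSemigroup.

Theorem theorem1p1 (n : nat) (hn : 3 <= n) :
  (exists S : semigroupType,
      centrefree S /\ graph_iso (cycle_graph n) (commuting_graph S))
  <-> 4 %| n.
Proof.
have n_gt0 : 0 < n by apply: leq_trans hn.
split=> [[S [Sc [f f_bij f_adj]]]|n4].
  exact (commuting_cycle_dvd4 n_gt0 Sc f_bij f_adj hn).
exists (fold_semigroup n4); split; first exact: fold_semigroup_centrefree.
exact: cycle_iso_fold_semigroup.
Qed.
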